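(* Let $A$ be a unital ring, $P_A$ a finitely generated projective generator right $A$-module, and $B=\operatorname{End}_A(P)$. (i) If $P$ can be generated by $n$ elements as a right $A$-module, then $\operatorname{sr}(A)\le n\cdot\operatorname{sr}(B)-n+1$. (ii) If there exist $f_1,\dots,f_t\in\operatorname{Hom}_A(P,A)$ such that $\sum_{i=1}^t f_i(P)=A$, then $\operatorname{sr}(B)\le t\cdot\operatorname{sr}(A)-t+1$.
   Context: A row $(a_1,\dots,a_n)\in A^n$ is right unimodular if $\sum_{i=1}^n a_iA=A$. A row $(a_1,\dots,a_n,b)\in A^{n+1}$ is reducible if there exist $c_1,\dots,c_n\in A$ such that $(a_1+bc_1,\dots,a_n+bc_n)$ is right unimodular. The (Bass) stable rank $\operatorname{sr}(A)$ of a unital ring is the least positive integer $n$ such that every right unimodular row in $A^{n+1}$ is reducible, or $\infty$ if no such $n$ exists. *)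

(* Defs.v *)
From HB Require Import structures.
From mathcomp Require Import all_boot all_order all_algebra.
Set Implicit Arguments. Unset Strict Implicit. Unset Printing Implicit Defensive.
Import GRing.Theory.
Local Open Scope ring_scope.

(* Unital rings are [pzRingType] (the zero ring is allowed).
   A right A-module is a left module over the converse ring A^c;
   the right action of a on v is [rsc v a] := a *: v computed in A^c,
   so that rsc (rsc v a) b = rsc v (a * b) (product in A). *)

Definition rsc (A : pzRingType) (M : lmodType A^c) (v : M) (a : A) : M :=
  (a : A^c) *: v.

Definition is_hom (A : pzRingType) (M N : lmodType A^c) (f : M -> N) : Prop :=
  (forall x y, f (x + y) = f x + f y) /\ (forall x a, f (rsc x a) = rsc (f x) a).

Definition is_hom_to_A (A : pzRingType) (M : lmodType A^c) (f : M -> A) : Prop :=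
  (forall x y, f (x + y) = f x + f y) /\ (forall x a, f (rsc x a) = f x * a).

Definition generated_by (A : pzRingType) (M : lmodType A^c) (n : nat) : Prop :=
  exists p : 'I_n -> M, forall v : M, exists a : 'I_n -> A,
    v = \sum_(i < n) rsc (p i) (a i).

Definition fin_gen (A : pzRingType) (M : lmodType A^c) : Prop :=
  exists n, generated_by M n.

Definition projective (A : pzRingType) (P : lmodType A^c) : Prop :=
  forall (M N : lmodType A^c) (g : M -> N) (h : P -> N),
    is_hom g -> (forall y, exists x, g x = y) -> is_hom h ->
    exists k : P -> M, is_hom k /\ (forall v, g (k v) = h v).

(* Generator of Mod-A: Hom_A(P, -) is faithful, i.e. a homomorphism
   g : M -> N vanishing on the images of all homomorphisms P -> M is 0. *)
Definition generator (A : pzRingType) (P : lmodType A^c) : Prop :=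
  forall (M N : lmodType A^c) (g : M -> N), is_hom g ->
    (forall h : P -> M, is_hom h -> forall v, g (h v) = 0) ->
    forall x, g x = 0.

(* B "is" End_A(P): the map act : B -> (P -> P) is a ring isomorphism
   from B onto the ring of A-linear endomorphisms of P (composition
   (f g)(v) = f (g v)). *)
Definition is_End_of (A : pzRingType) (P : lmodType A^c) (B : pzRingType)
    (act : B -> P -> P) : Prop :=
  [/\ forall b, is_hom (act b),
      forall f : P -> P, is_hom f -> exists b, forall v, act b v = f v,
      forall b1 b2, (forall v, act b1 v = act b2 v) -> b1 = b2,
      forall b1 b2 v, act (b1 + b2) v = act b1 v + act b2 v &
      (forall b1 b2 v, act (b1 * b2) v = act b1 (act b2 v)) /\
      (forall v, act 1 v = v)].

Definition right_unimodular (R : pzRingType) (m : nat) (a : 'I_m -> R) : Prop :=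
  exists x : 'I_m -> R, \sum_(i < m) a i * x i = 1.

Definition reducible (R : pzRingType) (n : nat) (a : 'I_n -> R) (b : R) : Prop :=
  exists c : 'I_n -> R, right_unimodular (fun i => a i + b * c i).

Definition sr_condition (R : pzRingType) (n : nat) : Prop :=
  forall a : 'I_n.+1 -> R, right_unimodular a ->
    reducible (fun i : 'I_n => a (widen_ord (leqnSn n) i)) (a ord_max).

Definition stable_rank_eq (R : pzRingType) (s : nat) : Prop :=
  (0 < s)%N /\ sr_condition R s /\ (forall m, (0 < m < s)%N -> ~ sr_condition R m).

(* Main.v *)
From HB Require Import structures.
Require Import Defs.
From mathcomp Require Import all_boot all_order all_algebra.
From mathcomp Require Import boolp.
Set Implicit Arguments. Unset Strict Implicit. Unset Printing Implicit Defensive.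
Import GRing.Theory.
Local Open Scope quotient_scope.
Local Open Scope ring_scope.

(* Say that W substitutes for V if for every split epimorphism
   (f, g) : W + X -> V some f + g h : W -> V is a split epimorphism.  The ring
   End(V) has stable rank at most n exactly when V^n substitutes for V.  Let U
   have s = sr(End(U)) finite.  Clearing one row at a time, U^(s-1) + U^k
   substitutes for U^k, k > 0.  If V is a summand of U^k, adding the identity
   of a complement shows that U^(s-1) + V substitutes for V.  If moreover U is
   a summand of V^t, then V^(t(s-1)+1) substitutes for V, because substituting
   for V passes to modules containing the substitute as a summand.  The two
   claims are the cases (U, V) = (P, A) and (U, V) = (A, P). *)


(** * Closure properties of homomorphisms of right modules *)

Section Homomorphisms.
Variable A : pzRingType.
Implicit Types M N L : lmodType A^c.

Lemma homD M N (f : M -> N) : is_hom f -> {morph f : x y / x + y}.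
Proof. by case. Qed.

Lemma hom0 M N (f : M -> N) : is_hom f -> f 0 = 0.
Proof. by move=> hf; apply: (addrI (f 0)); rewrite -homD // !addr0. Qed.

Lemma homN M N (f : M -> N) : is_hom f -> {morph f : x / - x}.
Proof.
by move=> hf x; apply: (addrI (f x)); rewrite -homD // !subrr hom0.
Qed.

Lemma homB M N (f : M -> N) : is_hom f -> {morph f : x y / x - y}.
Proof. by move=> hf x y; rewrite homD // homN. Qed.

Lemma hom_sum M N (f : M -> N) (I : finType) (F : I -> M) :
  is_hom f -> f (\sum_i F i) = \sum_i f (F i).
Proof. by move=> hf; rewrite (big_morph f (homD hf) (hom0 hf)). Qed.

Lemma hom_id M : is_hom (fun x : M => x).
Proof. by []. Qed.

Lemma hom_zero M N : is_hom (fun _ : M => 0 : N).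
Proof. by split=> [x y|x a]; rewrite /rsc ?addr0 ?scaler0. Qed.

Lemma hom_comp M N L (f : N -> L) (g : M -> N) :
  is_hom f -> is_hom g -> is_hom (fun x => f (g x)).
Proof. by move=> [fD fZ] [gD gZ]; split=> [x y|x a]; rewrite ?gD ?gZ. Qed.

Lemma hom_add M N (f g : M -> N) :
  is_hom f -> is_hom g -> is_hom (fun x => f x + g x).
Proof.
move=> [fD fZ] [gD gZ]; split=> [x y|x a]; first by rewrite fD gD addrACA.
by rewrite fZ gZ /rsc scalerDr.
Qed.

Lemma hom_opp M N (f : M -> N) : is_hom f -> is_hom (fun x => - f x).
Proof.
move=> [fD fZ]; split=> [x y|x a]; first by rewrite fD opprD.
by rewrite fZ /rsc scalerN.
Qed.

Lemma hom_pair M N L (f : M -> N) (g : M -> L) :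
  is_hom f -> is_hom g -> is_hom (fun x => (f x, g x) : N * L).
Proof. by move=> [fD fZ] [gD gZ]; split=> [x y|x a]; rewrite ?fD ?gD ?fZ ?gZ. Qed.

Lemma hom_fst M N L (f : M -> N * L) : is_hom f -> is_hom (fun x => (f x).1).
Proof. by move=> [fD fZ]; split=> [x y|x a]; rewrite ?fD ?fZ. Qed.

Lemma hom_snd M N L (f : M -> N * L) : is_hom f -> is_hom (fun x => (f x).2).
Proof. by move=> [fD fZ]; split=> [x y|x a]; rewrite ?fD ?fZ. Qed.

Lemma hom_prodE M N L (f : M * N -> L) (x : M) (y : N) :
  is_hom f -> f (x, y) = f (x, 0) + f (0, y).
Proof.
by move=> hf; rewrite -homD //; congr f; congr pair; rewrite ?addr0 ?add0r.
Qed.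

End Homomorphisms.

Ltac hom :=
  lazymatch goal with
  | |- is_hom (fun x => x) => exact: hom_id
  | |- is_hom (fun x => 0) => exact: hom_zero
  | |- is_hom (fun x => @?f x + @?g x) => apply: (@hom_add _ _ _ f g); hom
  | |- is_hom (fun x => - @?f x) => apply: (@hom_opp _ _ _ f); hom
  | |- is_hom (fun x => (@?f x, @?g x)) => apply: (@hom_pair _ _ _ _ f g); hom
  | |- is_hom (fun x => (@?f x).1) => apply: (@hom_fst _ _ _ _ f); hom
  | |- is_hom (fun x => (@?f x).2) => apply: (@hom_snd _ _ _ _ f); hom
  | |- is_hom (fun x => ?f x) => first [assumption | by []]
  | |- is_hom (fun x => ?f (@?g x)) => apply: (@hom_comp _ _ _ _ f g); hom
  | _ => first [assumption | by []]
  end.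

(** * The substitution property, its transfer between modules, and row clearing *)

Section Substitution.
Variable A : pzRingType.
Implicit Types K M N L U V W X : lmodType A^c.

(** [M] is a direct summand of [N]. Only the two maps are recorded; the idempotent [i p] replaces an
    explicit complement. *)
Definition retract M N : Prop :=
  exists i p, [/\ is_hom (i : M -> N), is_hom (p : N -> M) & cancel i p].

(** For [W = V^n] and [X = V], the components of [f] followed by [g] form a row over End(V). A split
    pair is then a right unimodular row, and [reducible_pair] below is its reducibility. *)
Definition split_pair W X V (f : W -> V) (g : X -> V) : Prop :=
  exists u v, [/\ is_hom (u : V -> W), is_hom (v : V -> X) &
    forall y, f (u y) + g (v y) = y].

Definition reducible_pair W X V (f : W -> V) (g : X -> V) : Prop :=
  exists h k, [/\ is_hom (h : W -> X), is_hom (k : V -> W) &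
    forall y, f (k y) + g (h (k y)) = y].

(* For [W = V^n] this property is equivalent to [sr_condition (End V) n]. *)
Definition substitutes W V : Prop :=
  forall X (f : W -> V) (g : X -> V), is_hom f -> is_hom g ->
    split_pair f g -> reducible_pair f g.

Lemma retract_refl M : retract M M.
Proof. by exists id, id. Qed.

Lemma retract_trans M N L : retract M N -> retract N L -> retract M L.
Proof.
move=> [i [p [hi hp ipK]]] [j [q [hj hq jqK]]].
exists (fun x => j (i x)), (fun z => p (q z)); split; try hom.
by move=> x; rewrite jqK ipK.
Qed.

Lemma retract_prod M N M' N' :
  retract M N -> retract M' N' -> retract (M * M')%type (N * N')%type.
Proof.
move=> [i [p [hi hp ipK]]] [j [q [hj hq jqK]]].
exists (fun x => (i x.1, j x.2)), (fun z => (p z.1, q z.2)); split; try hom.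
by case=> x y /=; rewrite ipK jqK.
Qed.

Lemma split_pair_shift W X V (f : W -> V) (g : X -> V) (h : W -> X) :
  is_hom g -> is_hom h ->
  split_pair f g -> split_pair (fun w => f w + g (h w)) g.
Proof.
move=> hg hh [u [v [hu hv uv]]].
exists u, (fun y => v y - h (u y)); split=> [||y]; try hom.
by rewrite homB // addrA addrAC addrK uv.
Qed.

Lemma reducible_pair_shift W X V (f : W -> V) (g : X -> V) (h : W -> X) :
  is_hom g -> is_hom h ->
  reducible_pair (fun w => f w + g (h w)) g -> reducible_pair f g.
Proof.
move=> hg hh [h' [k [hh' hk E]]].
exists (fun w => h w + h' w), k; split=> [||y]; try hom.
by rewrite homD // addrA E.
Qed.

Lemma split_pair_comp W W' X V (f : W -> V) (g : X -> V)
    (t : W' -> W) (t' : W -> W') :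
  is_hom t' -> cancel t' t ->
  split_pair f g -> split_pair (fun w => f (t w)) g.
Proof.
move=> ht' tK [u [v [hu hv uv]]].
by exists (fun y => t' (u y)), v; split=> [||y]; try hom; rewrite tK.
Qed.

Lemma reducible_pair_comp W W' X V (f : W -> V) (g : X -> V)
    (t : W' -> W) (t' : W -> W') :
  is_hom t -> is_hom t' -> cancel t t' ->
  reducible_pair (fun w => f (t w)) g -> reducible_pair f g.
Proof.
move=> ht ht' tK [h [k [hh hk E]]].
exists (fun w => h (t' w)), (fun y => t (k y)); split=> [||y]; try hom.
by rewrite tK E.
Qed.

(** The complement [ker p] of [W] in [W'] is moved to the other side: the pair is read as a map from
    [W] plus a map from [W' * X], in which [W'] acts through [1 - i p]. *)
Lemma substitutes_retract W W' V :
  retract W W' -> substitutes W V -> substitutes W' V.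
Proof.
move=> [i [p [hi hp ipK]]] sW X f g hf hg [u [v [hu hv uv]]].
have [||| h [k [hh hk E]]] := sW (W' * X)%type (fun w => f (i w))
  (fun z => f (z.1 - i (p z.1)) + g z.2); try hom.
  exists (fun y => p (u y)), (fun y => (u y, v y)); split=> [||y]; try hom.
  by rewrite /= homB // addrA addrCA subrr addr0 uv.
(* The [ker p] part of [h] is put back into the section. Applying [p] to the new section returns
   [k y], so [h (p w)] recovers [h (k y)]. *)
exists (fun w => (h (p w)).2),
  (fun y => i (k y) + ((h (k y)).1 - i (p (h (k y)).1))); split=> [||y]; try hom.
rewrite (homD hp) (homB hp) !ipK subrr addr0.
by rewrite (homD hf) -addrA E.
Qed.

Lemma substitutes_iso W V V' (i : V -> V') (p : V' -> V) :
  is_hom i -> is_hom p -> cancel i p -> cancel p i ->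
  substitutes W V -> substitutes W V'.
Proof.
move=> hi hp ipK piK sW X f g hf hg [u [v [hu hv uv]]].
have [||| h [k [hh hk E]]] := sW X (fun w => p (f w)) (fun x => p (g x)); try hom.
  exists (fun y => u (i y)), (fun y => v (i y)); split=> [||y]; try hom.
  by rewrite -homD // uv ipK.
exists h, (fun y => k (p y)); split=> [||y]; try hom.
by apply: (can_inj piK); rewrite homD // E.
Qed.

(* The idempotent [1 - i p] of [M] plays the role of a complement of [V]. *)
Lemma substitutes_summand W M V : retract V M ->
  substitutes (W * M)%type M -> substitutes (W * V)%type V.
Proof.
move=> [i [p [hi hp ipK]]] sM X f g hf hg [u [v [hu hv uv]]].
have [||| h [k [hh hk E]]] := sM X
  (fun z => i (f (z.1, p z.2)) + (z.2 - i (p z.2))) (fun x => i (g x)); try hom.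
  exists (fun m => ((u (p m)).1, i (u (p m)).2 + (m - i (p m)))), (fun m => v (p m)).
  split=> [||m]; try hom.
  rewrite /= [p (_ + _)]homD // [p (m - _)]homB // !ipK subrr addr0 -surjective_pairing.
  by rewrite addrAC -homD // uv addrAC subrr add0r addrC subrK.
exists (fun z => h (z.1, i z.2)), (fun y => ((k (i y)).1, p (k (i y)).2)).
split=> [||y]; try hom.
have {}E := E (i y); set z := k (i y) in E *.
have E1 : f (z.1, p z.2) + g (h z) = y.
  by rewrite -[RHS]ipK -E !(homD hp) (homN hp) !ipK subrr addr0.
(* Comparing [E] with [i] applied to [E1] shows that [1 - i p] kills [z.2]. Hence the section
   already lands in the image of [V], and [h] is evaluated at [z] itself. *)
have z2E : i (p z.2) = z.2.
  move: E; rewrite -E1 (homD hi) addrAC -[RHS]addr0 => /addrI /eqP.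
  by rewrite subr_eq0 => /eqP.
by rewrite /= z2E -surjective_pairing.
Qed.

(** Gaussian elimination: the second row forces the [U] coordinate to be [y.2 - (g x).2].
    Substituting this into the first row leaves a pair onto [M], with maps [(f (k, 0)).1] and
    [(g x).1 - (f (0, (g x).2)).1], to which [sK] applies. *)
Lemma reducible_pair_triangular K U M X (f : K * U -> M * U) (g : X -> M * U) :
  substitutes K M -> is_hom f -> is_hom g ->
  (forall z, (f z).2 = z.2) -> split_pair f g -> reducible_pair f g.
Proof.
move=> sK hf hg f2 [u [v [hu hv uv]]].
have fE k t : (f (k, t)).1 = (f (k, 0)).1 + (f (0, t)).1.
  by rewrite hom_prodE.
have [||| h [k [hh hk E]]] := sK X (fun k => (f (k, 0)).1)
  (fun x => (g x).1 - (f (0, (g x).2)).1); try hom.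
  exists (fun m => (u (m, 0)).1), (fun m => v (m, 0)); split=> [||m]; try hom.
  have := uv (m, 0); set z := u _; set x := v _ => E.
  have E1 : (f z).1 + (g x).1 = m by rewrite -[RHS]/((m, 0 : U).1) -E.
  have E2 : z.2 + (g x).2 = 0 by rewrite -[RHS]/((m, 0 : U).2) -E -f2.
  rewrite -[RHS]E1 [z in RHS]surjective_pairing fE.
  rewrite (canRL (addrK _) E2) sub0r.
  have -> : (0, - (g x).2) = - (0, (g x).2) :> K * U by congr pair; rewrite oppr0.
  by rewrite [f (- _)]homN // addrA addrAC.
exists (fun z => h z.1), (fun y => let k' := k (y.1 - (f (0, y.2)).1) in
  (k', y.2 - (g (h k')).2)); split=> [||y]; cbv zeta; try hom.
set x := k _ in E *; have := E (y.1 - (f (0, y.2)).1); rewrite -/x => {}E.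
rewrite [LHS]surjective_pairing [RHS]surjective_pairing; congr pair; last first.
  by rewrite -[LHS]/((f _).2 + (g _).2) f2 subrK.
rewrite -[LHS]/((f _).1 + (g _).1) fE.
have -> : (0, y.2 - (g (h x)).2) = (0, y.2) - (0, (g (h x)).2) :> K * U.
  by congr pair; rewrite subr0.
have fstB (m m' : M * U) : (m - m').1 = m.1 - m'.1 by [].
rewrite (homB hf) fstB -[RHS](subrK (f (0, y.2)).1) -E -!addrA; congr (_ + _).
by rewrite addrCA [RHS]addrCA; congr (_ + _); rewrite addrC.
Qed.

(* [s] splits the second row of [f] on [W * U]; as the last factor of
   [M * U] is also a copy of [U], an automorphism moves the split part there. *)
Lemma reducible_pair_split_row W U M X
    (f : (W * U) * (M * U) -> (M * U) * U) (g : X -> (M * U) * U)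
    (s : U -> W * U) :
  substitutes (W * (M * U))%type (M * U)%type ->
  is_hom f -> is_hom g -> is_hom s -> (forall t, (f (s t, 0)).2 = t) ->
  split_pair f g -> reducible_pair f g.
Proof.
move=> sM hf hg hs fs fg.
pose a (y : W * U) := (f (y, 0)).2.
pose b (m : M * U) := (f (0, m)).2.
have ha : is_hom a by rewrite /a; hom.
have hb : is_hom b by rewrite /b; hom.
have f2 y m : (f (y, m)).2 = a y + b m.
  by rewrite hom_prodE.
pose d (m : M * U) := s (m.2 - b m).
have hd : is_hom d by rewrite /d; hom.
pose q (z : ((W * U) * M) * U) : M * U := (z.1.2, z.2 - a z.1.1).
have hq : is_hom q by rewrite /q; hom.
(* The second row of [f] at [T z] is [a z.1.1 + a (d (q z)) + b (q z)]. Since [a] inverts [s], the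
   middle term is [(q z).2 - b (q z)]; the terms in [b] cancel and [z.2] remains. Thus [f] composed
   with [T] is triangular. *)
pose T (z : ((W * U) * M) * U) : (W * U) * (M * U) := (z.1.1 + d (q z), q z).
pose T' (z : (W * U) * (M * U)) : ((W * U) * M) * U :=
  ((z.1 - d z.2, z.2.1), z.2.2 + a (z.1 - d z.2)).
have hT : is_hom T by rewrite /T; hom.
have hT' : is_hom T' by rewrite /T'; hom.
have TK : cancel T T'.
  by move=> [[y m] t]; rewrite /T' /= addrK subrK.
have T'K : cancel T' T.
  by move=> [y [m t]]; rewrite /T /q /= addrK subrK.
apply: (reducible_pair_comp hT hT' TK).
apply: reducible_pair_triangular; try hom.
- apply: substitutes_retract sM.
  exists (fun z => ((z.1, z.2.2), z.2.1)), (fun z => (z.1.1, (z.2, z.1.2))).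
  by split; try hom; move=> [w [m t]].
- move=> z; rewrite f2 homD // {1}/d /a fs -addrA subrK addrC.
  by rewrite /q /= subrK.
exact: split_pair_comp T'K fg.
Qed.

(** Applying [sU] to the last row, with [(M * U) * X] as the second summand, gives [h]. Its first
    component is an elementary automorphism of the source and its second one a shift of [f] by [g].
    After both operations [s] splits the last row already on [W * U]. *)
Lemma substitutes_step W U M :
  substitutes (W * U)%type U ->
  substitutes (W * (M * U))%type (M * U)%type ->
  substitutes ((W * U) * (M * U))%type ((M * U) * U)%type.
Proof.
move=> sU sM X f g hf hg fg; case: (fg) => u [v [hu hv uv]].
have [||| h [s [hh hs E]]] := sU ((M * U) * X)%type (fun y => (f (y, 0)).2)
  (fun z => (f (0, z.1)).2 + (g z.2).2); try hom.
  exists (fun t => (u (0, t)).1), (fun t => ((u (0, t)).2, v (0, t))).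
  split=> [||t]; try hom.
  rewrite addrA -[X in X + _]/((f _ + f _).2) -hom_prodE // -surjective_pairing.
  by rewrite -[LHS]/((f _ + g _).2) uv.
pose T (z : (W * U) * (M * U)) := (z.1, z.2 + (h z.1).1).
pose T' (z : (W * U) * (M * U)) := (z.1, z.2 - (h z.1).1).
have hT : is_hom T by rewrite /T; hom.
have hT' : is_hom T' by rewrite /T'; hom.
have TK : cancel T T' by move=> [y m]; rewrite /T' /= addrK.
have T'K : cancel T' T by move=> [y m]; rewrite /T /= subrK.
apply: (reducible_pair_comp hT hT' TK).
apply: (@reducible_pair_shift _ _ _ _ _ (fun z => (h z.1).2)); try hom.
apply: (reducible_pair_split_row sM (s := s)); try hom.
  move=> t; rewrite -[RHS]E /T /= add0r addrA; congr (_ + _).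
  by rewrite hom_prodE.
apply: split_pair_shift; try hom.
exact: split_pair_comp T'K fg.
Qed.

End Substitution.

(** * Finite powers of a module and exchange of substitutes between them *)

Section Powers.
Variable A : pzRingType.
Implicit Types M N L U V W X : lmodType A^c.

Definition pow V n : lmodType A^c := {ffun 'I_n -> V}.

Definition pow_inj V n (i : 'I_n) (v : V) : pow V n :=
  [ffun j => if j == i then v else 0].

Definition pow_snoc V n (z : pow V n * V) : pow V n.+1 :=
  [ffun i => oapp z.1 z.2 (unlift ord_max i)].

Definition pow_unsnoc V n (x : pow V n.+1) : pow V n * V :=
  ([ffun i => x (widen_ord (leqnSn n) i)], x ord_max).

Lemma widen_lift_max n (i : 'I_n) : widen_ord (leqnSn n) i = lift ord_max i.
Proof. by apply: val_inj; rewrite /= /bump leqNgt ltn_ord add0n. Qed.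

Lemma pow_hom M V n (F : 'I_n -> M -> V) : (forall i, is_hom (F i)) ->
  is_hom (fun x => [ffun i => F i x] : pow V n).
Proof.
by move=> hF; split=> [x y|x a]; apply/ffunP=> i; rewrite !ffunE; case: (hF i).
Qed.

Lemma hom_coord M V n (f : M -> pow V n) (i : 'I_n) :
  is_hom f -> is_hom (fun x => f x i).
Proof. by move=> [fD fZ]; split=> [x y|x a]; rewrite ?fD ?fZ ffunE. Qed.

Lemma hom_bigsum M V n (F : 'I_n -> M -> V) : (forall i, is_hom (F i)) ->
  is_hom (fun x => \sum_i F i x).
Proof.
move=> hF; split=> [x y|x a].
  by rewrite -big_split; apply: eq_bigr => i _; case: (hF i).
by rewrite /rsc scaler_sumr; apply: eq_bigr => i _; apply: (hF i).2.
Qed.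

Lemma pow_inj_hom V n (i : 'I_n) : is_hom (@pow_inj V n i).
Proof. by apply: pow_hom => j; case: eqP => _; hom. Qed.

Lemma hom_powE V N n (f : pow V n -> N) x :
  is_hom f -> f x = \sum_i f (pow_inj i (x i)).
Proof.
move=> hf; rewrite -hom_sum //; congr f; apply/ffunP=> j.
rewrite sum_ffunE (bigD1 j) //= ffunE eqxx big1 ?addr0 // => i ij.
by rewrite ffunE eq_sym (negPf ij).
Qed.

Lemma pow_snoc_hom V n : is_hom (@pow_snoc V n).
Proof.
apply: pow_hom => i; case: (unlift _ i) => [j|] /=; last by hom.
by apply: (@hom_coord _ _ _ (fun z => z.1)); hom.
Qed.

Lemma pow_unsnoc_hom V n : is_hom (@pow_unsnoc V n).
Proof.
apply: hom_pair; last exact: hom_coord (@hom_id _ _).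
by apply: pow_hom => i; exact: hom_coord (@hom_id _ _).
Qed.

Lemma pow_snocK V n : cancel (@pow_snoc V n) (@pow_unsnoc V n).
Proof.
case=> x v; congr pair; last by rewrite ffunE unlift_none.
by apply/ffunP=> i; rewrite !ffunE widen_lift_max liftK.
Qed.

Lemma pow_unsnocK V n : cancel (@pow_unsnoc V n) (@pow_snoc V n).
Proof.
move=> x; apply/ffunP=> i; rewrite ffunE.
by case: unliftP => [j|] -> //=; rewrite ffunE widen_lift_max.
Qed.

Lemma retract_pow_snoc V n : retract (pow V n * V)%type (pow V n.+1).
Proof.
exists (@pow_snoc V n), (@pow_unsnoc V n); split; last exact: pow_snocK.
  exact: pow_snoc_hom.
exact: pow_unsnoc_hom.
Qed.

Lemma retract_pow_unsnoc V n : retract (pow V n.+1) (pow V n * V)%type.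
Proof.
exists (@pow_unsnoc V n), (@pow_snoc V n); split; last exact: pow_unsnocK.
  exact: pow_unsnoc_hom.
exact: pow_snoc_hom.
Qed.

Lemma retract_pow_cat V m n : retract (pow V m * pow V n)%type (pow V (m + n)).
Proof.
exists (fun z : pow V m * pow V n =>
  [ffun i => match split i return V with inl j => z.1 j | inr j => z.2 j end]).
exists (fun x : pow V (m + n) =>
  ([ffun i => x (lshift n i)], [ffun i => x (rshift m i)])).
split.
- apply: pow_hom => i; case: (split i) => j.
    by apply: (@hom_coord _ _ _ (fun z => z.1)); hom.
  by apply: (@hom_coord _ _ _ (fun z => z.2)); hom.
- by apply: hom_pair; apply: pow_hom => i; exact: hom_coord (@hom_id _ _).
case=> x y; congr pair; apply/ffunP=> i; rewrite !ffunE.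
  by rewrite (unsplitK (inl _ i)).
by rewrite (unsplitK (inr _ i)).
Qed.

Lemma retract_pow0 V W : retract (pow V 0) W.
Proof.
exists (fun=> 0), (fun=> 0); split; try hom.
by move=> x; apply/ffunP=> -[].
Qed.

Lemma retract_pow_pow U V t k : retract U (pow V t) ->
  retract (pow U k) (pow V (t * k)).
Proof.
move=> UV; elim: k => [|k IHk]; first exact: retract_pow0.
apply: retract_trans (retract_pow_unsnoc _ _) _.
rewrite mulnSr; apply: retract_trans (retract_pow_cat _ _ _).
exact: retract_prod.
Qed.

(** Each use of [substitutes_step] adds one factor [U] on both sides, so the excess [W] stays the
    same while the power grows. The form [pow U n * U] keeps a last factor available at every
    stage. *)
Lemma substitutes_pow W U n : substitutes (W * U)%type U ->
  substitutes (W * (pow U n * U))%type (pow U n * U)%type.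
Proof.
move=> sU; elim: n => [|n IHn].
  apply: (@substitutes_iso _ _ _ _ (fun t => (0, t)) (fun z => z.2)); try hom.
    by case=> x t; congr pair; apply/ffunP=> -[].
  apply: substitutes_retract sU.
  by exists (fun z => (z.1, (0, z.2))), (fun z => (z.1, z.2.2)); split; try hom; case.
have hsnoc := @pow_snoc_hom U n; have hunsnoc := @pow_unsnoc_hom U n.
apply: (@substitutes_iso _ _ _ _ (fun z => (pow_snoc z.1, z.2))
  (fun z => (pow_unsnoc z.1, z.2))); try hom.
- by case=> x t /=; rewrite pow_snocK.
- by case=> x t /=; rewrite pow_unsnocK.
apply: substitutes_retract (substitutes_step sU IHn).
exists (fun z => (z.1.1, (pow_snoc z.2, z.1.2))),
  (fun z => ((z.1, z.2.2), pow_unsnoc z.2.1)); split; try hom.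
by case=> [[w t] x] /=; rewrite pow_snocK.
Qed.

Lemma substitutes_pow_exchange U V s t k :
  retract U (pow V t) -> retract V (pow U k) ->
  substitutes (pow U s.+1) U -> substitutes (pow V (t * s).+1) V.
Proof.
move=> UV VU sU.
have {}sU := substitutes_pow (n := k)
  (substitutes_retract (retract_pow_unsnoc _ _) sU).
(* A spare factor [U] fits [V] into the shape [pow U k * U], which also covers [k = 0]. *)
have {}VU : retract V (pow U k * U)%type.
  apply: retract_trans VU _.
  by exists (fun x => (x, 0)), (fun z => z.1); split; try hom.
(* It remains to embed [pow U s * V] as a summand of the power [(t * s).+1] of [V]: [pow U s] goes
   into [pow V (t * s)], and [V] is the last factor. *)
apply: substitutes_retract (substitutes_summand VU sU).
apply: retract_trans (retract_pow_snoc _ _).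
by apply: retract_prod (retract_refl _); apply: retract_pow_pow.
Qed.

End Powers.

(** * The stable rank condition on an endomorphism ring, read as substitution *)

Section Endomorphisms.
Variables (A : pzRingType) (V : lmodType A^c) (B : pzRingType).
Variable act : B -> V -> V.
Hypothesis actP : is_End_of act.

Lemma act_hom b : is_hom (act b).
Proof. by case: actP. Qed.

Lemma act_surj (f : V -> V) : is_hom f -> exists b, forall v, act b v = f v.
Proof. by case: actP => _ + _ _ _; apply. Qed.

Lemma act_inj b c : (forall v, act b v = act c v) -> b = c.
Proof. by case: actP => _ _ + _ _; apply. Qed.

Lemma actD b c v : act (b + c) v = act b v + act c v.
Proof. by case: actP => _ _ _ + _; apply. Qed.

Lemma actM b c v : act (b * c) v = act b (act c v).
Proof. by case: actP => _ _ _ _ [+ _]; apply. Qed.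

Lemma act1 v : act 1 v = v.
Proof. by case: actP => _ _ _ _ [_]; apply. Qed.

Lemma act_sum (I : finType) (b : I -> B) v :
  act (\sum_i b i) v = \sum_i act (b i) v.
Proof.
apply: (big_morph (act^~ v)) => [b1 b2|]; first exact: actD.
by apply: (addrI (act 0 v)); rewrite -actD !addr0.
Qed.

(** An arbitrary [X] enters only through the endomorphism [g v] of [V], where [(u, v)] is the given
    section. The row consists of the components of [f] followed by [g v], and it is unimodular with
    the components of [u] followed by [1]. Composing the resulting [c] with [v] gives the map into
    [X]. *)
Lemma sr_condition_substitutes n : sr_condition B n -> substitutes (pow V n) V.
Proof.
move=> srB X f g hf hg [u [v [hu hv uv]]].
have /fin_all_exists [a aE] (i : 'I_n) :
    exists a, forall y, act a y = f (pow_inj i y).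
  by apply: act_surj; have hi := @pow_inj_hom _ V n i; hom.
have /fin_all_exists [x xE] (i : 'I_n) : exists x, forall y, act x y = u y i.
  by apply: act_surj; apply: hom_coord.
have [b bE] : exists b, forall y, act b y = g (v y) by apply: act_surj; hom.
pose row (c : 'I_n -> B) d (i : 'I_n.+1) := oapp c d (unlift ord_max i).
have rowE c d i : row c d (widen_ord (leqnSn n) i) = c i.
  by rewrite /row widen_lift_max liftK.
have row_max c d : row c d ord_max = d by rewrite /row unlift_none.
have [|c [x' x'E]] := srB (row a b).
  exists (row x 1); rewrite big_ord_recr /= !row_max mulr1.
  apply: act_inj => y; rewrite actD act_sum act1 bE -[RHS]uv; congr (_ + _).
  by rewrite [RHS]hom_powE //; apply: eq_bigr => i _; rewrite !rowE actM aE xE.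
exists (fun z : pow V n => v (\sum_i act (c i) (z i))),
  (fun y => [ffun i => act (x' i) y]).
split=> [||y].
- apply: (hom_comp hv); apply: hom_bigsum => i.
  exact: hom_comp (act_hom _) (hom_coord i (@hom_id _ _)).
- by apply: pow_hom => i; exact: act_hom.
rewrite -bE hom_powE // hom_sum ?act_hom; last exact: act_hom.
rewrite -big_split -[RHS]act1 -x'E act_sum; apply: eq_bigr => i _.
by rewrite rowE row_max ffunE actM actD actM aE.
Qed.

Lemma substitutes_sr_condition n : substitutes (pow V n) V -> sr_condition B n.
Proof.
move=> sV a [x]; rewrite big_ord_recr /= => xE.
set w := widen_ord (leqnSn n) in xE *.
have hact := act_hom.
have hf : is_hom (fun z : pow V n => \sum_i act (a (w i)) (z i)).
  by apply: hom_bigsum => i; exact: hom_comp (act_hom _) (hom_coord i (@hom_id _ _)).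
have [|h [k [hh hk E]]] := sV V _ _ hf (act_hom (a ord_max)).
  exists (fun y => [ffun i => act (x (w i)) y]), (act (x ord_max)); split=> // [|y].
    by apply: pow_hom => i; exact: act_hom.
  rewrite -[RHS]act1 -xE actD act_sum actM; congr (_ + _).
  by apply: eq_bigr => i _; rewrite ffunE actM.
have /fin_all_exists [c cE] (i : 'I_n) :
    exists c, forall y, act c y = h (pow_inj i y).
  by apply: act_surj; have hi := @pow_inj_hom _ V n i; hom.
have /fin_all_exists [x' x'E] (i : 'I_n) : exists x, forall y, act x y = k y i.
  by apply: act_surj; apply: hom_coord.
exists c, x'; apply: act_inj => y.
rewrite act1 -[RHS]E act_sum (hom_powE _ hh) hom_sum // -big_split.
by apply: eq_bigr => i _; rewrite actM actD actM x'E cE.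
Qed.

End Endomorphisms.

Lemma sr_condition_exchange (A B C : pzRingType) (U V : lmodType A^c)
    (actU : B -> U -> U) (actV : C -> V -> V) s t k :
  is_End_of actU -> is_End_of actV ->
  retract U (pow V t) -> retract V (pow U k) ->
  sr_condition B s.+1 -> sr_condition C (t * s).+1.
Proof.
move=> actUP actVP UV VU /(sr_condition_substitutes actUP) sU.
apply: (substitutes_sr_condition actVP).
exact: substitutes_pow_exchange UV VU sU.
Qed.

(** The least exponent exists by well-ordering; classical reflection turns the condition into a
    boolean predicate for the minimum search. *)
Lemma stable_rank_le (R : pzRingType) n : (0 < n)%N -> sr_condition R n ->
  exists r, stable_rank_eq R r /\ (r <= n)%N.
Proof.
move=> n0 srn; pose S m := `[< (0 < m)%N /\ sr_condition R m >].
have exS : exists m, S m by exists n; apply/asboolP.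
case: (ex_minnP exS) => r /asboolP[r0 srr] rmin; exists r; split; last first.
  by apply: rmin; apply/asboolP.
split=> //; split=> // m /andP[m0 mr] srm.
by move: mr; rewrite ltnNge rmin //; apply/asboolP.
Qed.

(** * The quotient of a module by a submodule *)

Section ModuleQuotient.
Variables (R : pzRingType) (M : lmodType R) (S : zmodClosed M).
Hypothesis scaleS : GRing.scaler_closed S.

Local Notation Q := (Quotient.quot S).

Definition quot_scale (a : R) (x : Q) : Q := \pi_Q (a *: repr x).

(** The choice of representative in [quot_scale] is harmless: two representatives differ by an
    element of [S], and [S] is stable under scaling. *)
Lemma pi_scale a (x : M) : \pi_Q (a *: x) = quot_scale a (\pi_Q x).
Proof.
apply/eqP; rewrite -Quotient.idealrBE -scalerBr scaleS //.
by rewrite Quotient.idealrBE reprK.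
Qed.

Lemma quot_scaleA a b x : quot_scale a (quot_scale b x) = quot_scale (a * b) x.
Proof. by elim/quotW: x => x; rewrite -(pi_scale b) -!pi_scale scalerA. Qed.

Lemma quot_scale1 : left_id 1 quot_scale.
Proof. by elim/quotW=> x; rewrite -pi_scale scale1r. Qed.

Lemma quot_scaleDr : right_distributive quot_scale +%R.
Proof.
move=> a; elim/quotW=> x; elim/quotW=> y; rewrite -raddfD -!pi_scale scalerDr.
exact: raddfD.
Qed.

Lemma quot_scaleDl x : {morph quot_scale^~ x : a b / a + b}.
Proof. by move=> a b; elim/quotW: x => x; rewrite -!pi_scale scalerDl raddfD. Qed.

Definition quot_lmod : lmodType R := HB.pack Q (GRing.Zmodule_isLmodule.Build R Q
  quot_scaleA quot_scale1 quot_scaleDr quot_scaleDl).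

Definition quot_proj (x : M) : quot_lmod := \pi_Q x.

Lemma quot_projD : {morph quot_proj : x y / x + y}.
Proof. by move=> x y; exact: raddfD. Qed.

Lemma quot_projZ a : {morph quot_proj : x / a *: x}.
Proof. exact: pi_scale. Qed.

Lemma quot_proj_eq0 x : quot_proj x = 0 <-> x \in S.
Proof.
have <- : quot_proj 0 = 0 by exact: raddf0.
rewrite -[x in x \in S]subr0 Quotient.idealrBE.
by split=> /eqP.
Qed.

End ModuleQuotient.

(** * The trace ideal of a module *)

Section Trace.
Variables (A : pzRingType) (P : lmodType A^c).

Definition in_trace (x : A) : Prop :=
  exists k (f : 'I_k -> P -> A) (p : 'I_k -> P),
    (forall i, is_hom_to_A (f i)) /\ \sum_i f i (p i) = x.

Definition trace : pred (A^c)^o := fun x => `[< in_trace x >].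

(** Right linearity moves a scalar into the arguments, [f (p) a = f (p a)], and a sum of two
    elements is handled by concatenating their families. *)
Lemma trace_submod_closed : submod_closed trace.
Proof.
split=> [|a x y /asboolP[k [f [p [hf <-]]]] /asboolP[l [g [q [hg <-]]]]].
  apply/asboolP; exists 0%N, (fun _ _ => 0), (fun=> 0).
  by rewrite big_ord0; split => // -[].
apply/asboolP; exists (k + l)%N,
  (fun i => match split i with inl j => f j | inr j => g j end),
  (fun i => match split i with inl j => rsc (p j) a | inr j => q j end).
split=> [i|]; first by case: split.
rewrite big_split_ord /=; congr (_ + _).
  rewrite [RHS]mulr_suml; apply: eq_bigr => i _.
  by rewrite (unsplitK (inl _ i)); case: (hf i).
by apply: eq_bigr => i _; rewrite (unsplitK (inr _ i)).
Qed.

HB.instance Definition _ := GRing.isZmodClosed.Build (A^c)^o trace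
  (GRing.submod_closedB trace_submod_closed).

(** The projection of [A] onto its quotient by the trace kills the image of every homomorphism from
    [P] to [A]. As [P] is a generator, this projection is zero, so [1] lies in the trace. *)
Lemma generator_trace : generator P -> in_trace 1.
Proof.
move=> genP.
pose g := quot_proj trace_submod_closed.
have hg : is_hom g by split; [exact: quot_projD | move=> x a; exact: quot_projZ].
have g_eq0 x : g x = 0 <-> in_trace x.
  by split=> [/quot_proj_eq0/asboolP // | xT]; apply/quot_proj_eq0/asboolP.
apply/g_eq0; apply: genP hg _ _ => h hh v; apply/g_eq0.
by exists 1%N, (fun=> h), (fun=> v); rewrite big_ord1.
Qed.

End Trace.

(** * The regular module [A], its endomorphisms, and its summand relations with [P] *)

Section Regular.
Variables (A : pzRingType) (P : lmodType A^c).
Local Notation AA := ((A^c)^o : lmodType A^c).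

(** Left multiplications commute with right scalars, and an endomorphism [f] is left multiplication
    by [f 1]. *)
Lemma regular_End : is_End_of (fun (a : A) (x : AA) => (a * x : A)).
Proof.
split=> [b|f [fD fZ]|b1 b2 E|b1 b2 v|].
- by split=> [x y|x a]; [exact: (@mulrDr A) | exact: (@mulrA A)].
- exists (f 1) => v; rewrite -[RHS](congr1 f (@mul1r A v)).
  exact: esym (fZ 1 v).
- by have := E (1 : A); rewrite !mulr1.
- exact: (@mulrDl A).
by split=> [b1 b2 v|v]; [rewrite mulrA | rewrite mul1r].
Qed.

(** The element [a] goes to the family of the [p i] times [a], and the [f i] bring it back to
    [(\sum_i f i (p i)) * a], which is [a]. *)
Lemma retract_regular t (f : 'I_t -> P -> A) (p : 'I_t -> P) :
  (forall i, is_hom_to_A (f i)) -> \sum_i f i (p i) = 1 -> retract AA (pow P t).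
Proof.
move=> hf fp1.
exists (fun a : AA => [ffun i => rsc (p i) a]), (fun x : pow P t => \sum_i f i (x i)).
split.
- apply: pow_hom => i; split=> [x y|x a]; first exact: scalerDl.
  by rewrite /rsc scalerA.
- apply: hom_bigsum => i.
  by apply: (@hom_comp _ _ _ AA (f i)); [exact: hf | exact: hom_coord (@hom_id _ _)].
move=> a; rewrite -[RHS](@mul1r A) -fp1 mulr_suml.
by apply: eq_bigr => i _; rewrite ffunE; case: (hf i).
Qed.

(** The generators define a surjection from the free module of rank [n] onto [P], and projectivity
    lifts the identity of [P] to a section. *)
Lemma retract_projective n : projective P -> generated_by P n -> retract P (pow AA n).
Proof.
move=> projP [p pP].
have hg : is_hom (fun a : pow AA n => \sum_i rsc (p i) (a i)).
  apply: hom_bigsum => i; apply: (@hom_comp _ _ AA _ (rsc (p i))).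
    by split=> [x y|x a]; rewrite /rsc ?scalerDl ?scalerA.
  exact: hom_coord (@hom_id _ _).
have [|k [hk kE]] := projP _ _ _ _ hg _ (@hom_id _ P).
  by move=> v; have [a ->] := pP v; exists [ffun i => a i]; apply: eq_bigr => i _; rewrite ffunE.
by exists k, (fun a : pow AA n => \sum_i rsc (p i) (a i)).
Qed.

End Regular.

Theorem theorem9 (A : pzRingType) (P : lmodType A^c) (B : pzRingType)
    (act : B -> P -> P) :
  fin_gen P -> projective P -> generator P -> is_End_of act ->
  (* (i) *)
  (forall n s : nat, generated_by P n -> stable_rank_eq B s ->
     exists r, stable_rank_eq A r /\ (r <= n * s - n + 1)%N) /\
  (* (ii) *)
  (forall (t : nat) (f : 'I_t -> P -> A),
     (forall i, is_hom_to_A (f i)) ->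
     (forall x : A, exists p : 'I_t -> P, \sum_(i < t) f i (p i) = x) ->
     forall s : nat, stable_rank_eq A s ->
     exists r, stable_rank_eq B r /\ (r <= t * s - t + 1)%N).
Proof.
move=> fgP projP genP actP; split=> [n s genPn|t f hf fP s] [s0 [srs _]].
  (* Here [U = P] and [V = A]: the [n] generators make [P] a summand of [A^n], and the trace makes
     [A] a summand of [P^k]. *)
  have [k [f [p [hf fp1]]]] := generator_trace genP.
  (* Writing the stable rank as [s.+1] turns the bound, stated with truncated subtraction, into
     exactly [(n * s).+1]. *)
  case: s s0 srs => // s _ srs; rewrite mulnS addKn addn1.
  apply: stable_rank_le => //.
  exact: sr_condition_exchange actP (@regular_End A)
    (retract_projective projP genPn) (retract_regular hf fp1) srs.
(* The roles are swapped, [U = A] and [V = P]: a preimage of [1] makes [A] a summand of [P^t], and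
   finite generation makes [P] a summand of some [A^k]. *)
have [k genPk] := fgP; have [p fp1] := fP 1.
case: s s0 srs => // s _ srs; rewrite mulnS addKn addn1.
apply: stable_rank_le => //.
exact: sr_condition_exchange (@regular_End A) actP
  (retract_regular hf fp1) (retract_projective projP genPk) srs.
Qed.
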